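(* Let $k\geq 1$ be an integer. For every $\varepsilon>0$ there exists an integer $N_{\varepsilon}$ (depending on $k$ and $\varepsilon$) such that if $G$ is a maximal $k$-degenerate graph with $n\geq N_{\varepsilon}$ vertices, then $$\max_{\mathcal{A}}CC(\mathcal{A})\leq\left(\frac{k^k}{(k+1)^{k+1}}+\varepsilon\right)n,$$ where the maximum is over all full information stopping algorithms $\mathcal{A}$ on $G$.
   Context: A graph is $k$-degenerate if every induced subgraph has a vertex of degree at most $k$. A graph $G$ is maximal $k$-degenerate if it is maximal with respect to inclusion of edges among $k$-degenerate graphs on its vertex set; equivalently (for $n\ge k$ vertices), there is an ordering $v_1,\dots,v_n$ of its vertices such that the first $k$ vertices form a clique and each remaining vertex is joined to exactly $k$ vertices earlier in the ordering. The vertices of $G$ become active one by one in a uniformly random order (permutation) $\sigma\in S_n$; $\sigma(i)$ denotes the $i$-th vertex to become active. $CC(\sigma,t)$ denotes the number of connected components of the induced subgraph $G[\{\sigma(1),\dots,\sigma(t)\}]$. A full information stopping algorithm on $G$ is a function $\mathcal{A}:S_n\to\{0,1,\dots,n\}$ such that for all $\sigma,\tau\in S_n$: if $\sigma(i)=\tau(i)$ for all $i\le\mathcal{A}(\sigma)$, then $\mathcal{A}(\tau)=\mathcal{A}(\sigma)$. (The algorithm knows $G$ in advance and at each time knows which vertices have become active, but not the order of the future vertices.) Its score is $CC(\mathcal{A})=\frac{1}{n!}\sum_{\sigma\in S_n}CC(\sigma,\mathcal{A}(\sigma))$. *)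

(* Defs.v *)
From mathcomp Require Import all_boot all_order all_algebra all_fingroup.
From mathcomp Require Import reals.

Set Implicit Arguments.
Unset Strict Implicit.
Unset Printing Implicit Defensive.

Import Order.TTheory GRing.Theory Num.Theory.

Local Open Scope ring_scope.

Record sgraph (T : finType) := SGraph {
  adj :> rel T;
  adj_sym : symmetric adj;
  adj_irrefl : irreflexive adj
}.

(* Induced subgraphs are over nonempty vertex sets S. *)
Definition degenerate (T : finType) (k : nat) (G : sgraph T) : Prop :=
  forall S : {set T}, S != set0 ->
    exists2 v, v \in S & (#|[set u in S | G v u]| <= k)%N.

Definition maximal_degenerate (T : finType) (k : nat) (G : sgraph T) : Prop :=
  degenerate k G /\
  forall H : sgraph T, subrel G H -> degenerate k H -> subrel H G.

(* All of T is kept as carrier, so vertices outside S are isolated here;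
   [components] below only counts the components lying in S. *)
Definition induced (T : finType) (G : sgraph T) (S : {set T}) : rel T :=
  [rel x y | [&& x \in S, y \in S & G x y]].

Definition components (T : finType) (G : sgraph T) (S : {set T}) : nat :=
  n_comp (induced G S) S.

(* Positions are numbered from 0, so these are the first t active vertices. *)
Definition active (n : nat) (sigma : 'S_n) (t : nat) : {set 'I_n} :=
  [set sigma i | i : 'I_n & (i < t)%N].

Definition CC (n : nat) (G : sgraph 'I_n) (sigma : 'S_n) (t : nat) : nat :=
  components G (active sigma t).

Definition stopping_algorithm (n : nat) (A : {ffun 'S_n -> 'I_n.+1}) : bool :=
  [forall sigma : 'S_n, forall tau : 'S_n,
    [forall i : 'I_n, (i < A sigma)%N ==> (sigma i == tau i)] ==>
    (A tau == A sigma)].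

Definition score (R : realType) (n : nat) (G : sgraph 'I_n)
    (A : {ffun 'S_n -> 'I_n.+1}) : R :=
  (n`!%:R)^-1 * \sum_(sigma : 'S_n) (CC G sigma (A sigma))%:R.

(* The default 0 is harmless: scores are nonnegative, and constant functions
   are stopping algorithms, so the range is nonempty. *)
Definition max_score (R : realType) (n : nat) (G : sgraph 'I_n) : R :=
  \big[Num.max/0]_(A : {ffun 'S_n -> 'I_n.+1} | stopping_algorithm A)
    score R G A.

(* Main.v *)
Require Import Defs.
From mathcomp Require Import all_boot all_order all_algebra all_fingroup.
From mathcomp Require Import reals.
From mathcomp Require Import zify ring lra.

(* A maximal k-degenerate graph has an ordering in which all but at most k
   vertices v have a set B v of k earlier neighbours.  A component of an induced
   subgraph is counted by its first vertex, so the number of components exceeds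
   by at most k the number of active v with B v inactive.
   For a fixed set C, [C is inactive]/(n - t)_|C| is a martingale in the time t.
   Writing the count of such v in terms of these martingales for B v and
   v |: B v gives
     t (n-t)_k/(n-k) * (martingale) + (n-t)_(k+1)/(n-k) * Q,
   with Q a martingale that starts at 0.  Under any stopping algorithm the first
   term is at most n max_p p(1-p)^k + O(1).  By optional stopping E|Q| is bounded
   by its value at a deterministic time T = n - n/q, where a second moment
   computation makes it negligible: the summands of Q are nearly uncorrelated,
   since of two vertices the later one lies in neither of the two neighbour sets.
   Stopping after T gains at most n/q, because a fixed B v is still inactive at
   time T with probability at most 1/q. *)

Set Implicit Arguments.
Unset Strict Implicit.
Unset Printing Implicit Defensive.

Import Order.TTheory GRing.Theory Num.Theory.

Local Open Scope ring_scope.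

(** * Degeneracy orderings and the component count *)

Section DegeneracyOrder.
Variables (T : finType) (k : nat).
Implicit Type G : sgraph T.

Definition earlier (r : T -> nat) G (v : T) : {set T} :=
  [set u | G v u && (r u < r v)%N].

(** A vertex of low degree is put last and the remaining vertices are ordered by induction. *)
Lemma degeneracy_order G : degenerate k G ->
  exists2 r : T -> nat, injective r & forall v, (#|earlier r G v| <= k)%N.
Proof.
move=> degG.
(* Bounding the ranks on [S] by [#|S|] leaves the rank [m] free for the vertex put last. *)
suff /(_ [set: T]) [r [_ rinj rk]] : forall S : {set T}, exists r : T -> nat,
    [/\ forall v, v \in S -> (r v < #|S|)%N, {in S &, injective r} &
        forall v, v \in S -> (#|[set u in S | G v u && (r u < r v)%N]| <= k)%N].
  exists r => [u v|v]; first by apply: rinj.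
  apply: leq_trans (rk v _) => //; apply: subset_leq_card.
  by apply/subsetP=> u; rewrite !inE.
move=> S; move: {2}#|S| (erefl #|S|) => m.
elim: m S => [|m IH] S cardS.
  by exists (fun=> 0%N); rewrite (cards0_eq cardS); split=> [v|u v|v]; rewrite in_set0.
have /degG[v vS vk] : S != set0 by rewrite -card_gt0 cardS.
have cardSv : #|S :\ v| = m by move: cardS; rewrite (cardsD1 v) vS => -[].
have [r [rlt rinj rk]] := IH _ cardSv.
have lt_m u : u \in S -> u != v -> (r u < m)%N.
  by move=> uS uv; rewrite -cardSv; apply: rlt; rewrite in_setD1 uv.
exists (fun u => if u == v then m else r u); split.
- move=> u uS; rewrite cardS; case: eqP => // /eqP uv.
  by rewrite ltnS ltnW ?lt_m.
- move=> u w uS wS; case: (eqVneq u v) => [->|uv]; case: (eqVneq w v) => [->|wv] //.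
  + by move=> E; have := lt_m w wS wv; rewrite -E ltnn.
  + by move=> E; have := lt_m u uS uv; rewrite E ltnn.
  + by apply: rinj; rewrite !inE ?uv ?wv.
move=> u uS; case: (eqVneq u v) => [->|uv].
  apply: leq_trans vk; apply: subset_leq_card; apply/subsetP=> w.
  by rewrite !inE => /and3P[-> ->].
have uSv : u \in S :\ v by rewrite !inE uv.
apply: leq_trans (rk u uSv); apply: subset_leq_card; apply/subsetP=> w.
rewrite !inE; case: eqP => [->|/eqP wv] /and3P[-> -> //].
by rewrite ltnNge ltnW ?lt_m.
Qed.

(** The vertex of largest rank in [S] has all its neighbours in [S] among its earlier ones. *)
Lemma order_degenerate (r : T -> nat) G :
  injective r -> (forall v, #|earlier r G v| <= k)%N -> degenerate k G.
Proof.
move=> rinj rk S /set0Pn[x xS].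
case: (arg_maxnP r xS) => v vS vmax; exists v => //.
apply: leq_trans (rk v); apply: subset_leq_card; apply/subsetP=> u.
rewrite !inE => /andP[uS Gvu]; have uv : (r u <= r v)%N := vmax u uS.
rewrite Gvu ltn_neqAle uv andbT /=.
by apply: contraTneq Gvu => /rinj ->; rewrite adj_irrefl.
Qed.

(** The guard [x != y] keeps the relation irreflexive, so [add_edge] has no side condition. *)
Definition add_edge_rel G (x y : T) : rel T :=
  fun u v => G u v || (x != y) && ((u == x) && (v == y) || (u == y) && (v == x)).

Lemma add_edge_sym G x y : symmetric (add_edge_rel G x y).
Proof.
move=> u v; rewrite /add_edge_rel adj_sym; congr (_ || (_ && _)).
by rewrite orbC ![_ && (u == _)]andbC.
Qed.

Lemma add_edge_irrefl G x y : irreflexive (add_edge_rel G x y).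
Proof.
move=> u; rewrite /add_edge_rel adj_irrefl /=; apply/negP => /andP[xy].
by case/orP=> /andP[/eqP uE /eqP uE']; rewrite -uE -uE' eqxx in xy.
Qed.

Definition add_edge G x y : sgraph T :=
  SGraph (add_edge_sym G x y) (add_edge_irrefl G x y).

(** Joining a vertex with fewer than [k] earlier neighbours to one more predecessor keeps the
    ordering a degeneracy ordering. By maximality such a vertex is already adjacent to all its
    predecessors, so it has fewer than [k] of them. *)
Lemma maximal_degenerate_order G : maximal_degenerate k G ->
  exists2 r : T -> nat, injective r &
    (#|[set v | (#|earlier r G v| < k)%N]| <= k)%N.
Proof.
move=> [/degeneracy_order[r rinj rk] maxG]; exists r => //.
have few v : (#|earlier r G v| < k)%N -> (#|[set u | (r u < r v)%N]| < k)%N.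
  move=> vk; apply: leq_ltn_trans (vk); apply: subset_leq_card.
  apply/subsetP=> u; rewrite !inE => uv; rewrite uv andbT.
  have vu : v != u by apply: contraTneq uv => ->; rewrite ltnn.
  have Gaddv : add_edge G v u v u by rewrite /= /add_edge_rel !eqxx vu orbT.
  have subG : subrel G (add_edge G v u).
    by move=> a b Gab; rewrite /= /add_edge_rel Gab.
  apply: (maxG _ subG _ v u Gaddv); apply: (order_degenerate rinj) => w.
  have [->|wv] := eqVneq w v.
    apply: (@leq_trans #|u |: earlier r G v|).
      apply: subset_leq_card; apply/subsetP=> a; rewrite !inE /= /add_edge_rel.
      rewrite eqxx vu /= (negbTE vu) /= orbF.
      by case/andP=> /orP[->->|->]; rewrite ?orbT.
    by rewrite cardsU1; case: (u \notin _); rewrite // add0n ltnW.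
  apply: leq_trans (rk w); apply: subset_leq_card; apply/subsetP=> a.
  rewrite !inE /= /add_edge_rel (negbTE wv) /=.
  case/andP=> /orP[->->//|/andP[_ /andP[/eqP -> /eqP ->]]].
  by move=> /(ltn_trans uv); rewrite ltnn.
set E := [set v | _]; have [->|/set0Pn[x xE]] := eqVneq E set0; first by rewrite cards0.
(* All other exceptional vertices precede the last one, which has fewer than [k] predecessors. *)
case: (arg_maxnP r xE) => v vE vmax.
have {}vE : v \in E by [].
have /few : (#|earlier r G v| < k)%N by move: vE; rewrite inE.
apply: leq_trans; rewrite (cardsD1 v) vE add1n ltnS.
apply: subset_leq_card; apply/subsetP=> u; rewrite !inE => /andP[uv uE].
rewrite ltn_neqAle (inj_eq rinj) uv /=.
by have : u \in E; [rewrite inE | move=> /vmax].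
Qed.

(** In each component the vertex of least rank has no earlier neighbour in [S]. *)
Lemma components_le (r : T -> nat) G (S : {set T}) : injective r ->
  (components G S <= #|[set v in S | [disjoint earlier r G v & S]]|)%N.
Proof.
move=> rinj; rewrite /components /n_comp_mem; set e := induced G S.
have esym : symmetric e.
  by move=> x y; rewrite /e /induced /= adj_sym; case: (x \in S); case: (y \in S).
have csym : connect_sym e by exact: sym_connect_sym.
have eS : closed e (mem S) by move=> x y /and3P[-> ->].
pose f x := [arg min_(y < x | connect e x y) r y].
have fP x : x \in S -> [/\ connect e x (f x), f x \in S & [disjoint earlier r G (f x) & S]].
  move=> xS; rewrite /f; case: arg_minnP => [|y xy ymin]; first exact: connect0.
  have yS : y \in S by rewrite -(closed_connect eS xy).
  split=> //; rewrite disjoints_subset; apply/subsetP=> u; rewrite !inE => /andP[Gyu uy].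
  apply/negP=> uS; have /ymin : connect e x u.
    by apply: connect_trans xy (connect1 _); rewrite /e /induced /= yS uS Gyu.
  by rewrite leqNgt uy.
(* On component roots [f] is injective: [f x] is connected to [x], so equal values force equal
   roots. *)
rewrite -[leqLHS](card_in_imset (f := f)) => [|x y].
  apply: subset_leq_card; apply/subsetP=> _ /imsetP[x /andP[_ /= xS] ->].
  by have [_ fS fd] := fP x xS; rewrite inE fS.
move=> /andP[/eqP rx /= xS] /andP[/eqP ry /= yS] fxy.
have [cx _ _] := fP x xS; have [cy _ _] := fP y yS.
by rewrite -rx -ry; apply/eqP; rewrite (root_connect csym) (connect_trans cx) // fxy csym.
Qed.

End DegeneracyOrder.

(** * Means over uniformly random permutations *)

Section Mean.
Variables (R : realType) (n : nat).

Definition mean (f : 'S_n -> R) : R := (n`!%:R)^-1 * \sum_(s : 'S_n) f s.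

Let fact_neq0 : n`!%:R != 0 :> R.
Proof. by rewrite pnatr_eq0 -lt0n fact_gt0. Qed.

Lemma eq_mean f g : f =1 g -> mean f = mean g.
Proof. by move=> fg; rewrite /mean (eq_bigr g). Qed.

Lemma mean_const c : mean (fun=> c) = c.
Proof.
by rewrite /mean sumr_const card_Sn -[c *+ _]mulr_natl mulKf.
Qed.

Lemma meanD f g : mean (fun s => f s + g s) = mean f + mean g.
Proof. by rewrite /mean big_split mulrDr. Qed.

Lemma meanZ c f : mean (fun s => c * f s) = c * mean f.
Proof. by rewrite /mean -mulr_sumr mulrCA. Qed.

Lemma mean_sum (I : Type) (r : seq I) (P : pred I) (F : I -> 'S_n -> R) :
  mean (fun s => \sum_(i <- r | P i) F i s) = \sum_(i <- r | P i) mean (F i).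
Proof. by rewrite /mean exchange_big mulr_sumr. Qed.

Lemma ler_mean f g : (forall s, f s <= g s) -> mean f <= mean g.
Proof.
by move=> fg; rewrite /mean ler_wpM2l ?invr_ge0 ?ler0n ?ler_sum.
Qed.

End Mean.

Lemma disjointsU (T : finType) (A B S : {set T}) :
  [disjoint A :|: B & S] = [disjoint A & S] && [disjoint B & S].
Proof. by rewrite !disjoints_subset subUset. Qed.

(** * Martingales of the active set and optional stopping *)

Section OptionalStopping.
Variables (R : realType) (n : nat).
Implicit Types (Phi : {set 'I_n} -> R) (S : {set 'I_n}).

(** The next vertex is uniform on [~: S]; its average is multiplied by [n - #|S|] to avoid a
    division. Only sets met before time [T] are constrained. *)
Definition submartingale (T : nat) Phi := forall S, (#|S| < T)%N ->
  (n - #|S|)%:R * Phi S <= \sum_(v in ~: S) Phi (v |: S).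

Definition martingale (T : nat) Phi := forall S, (#|S| < T)%N ->
  (n - #|S|)%:R * Phi S = \sum_(v in ~: S) Phi (v |: S).

Lemma card_active (s : 'S_n) t : (t <= n)%N -> #|active s t| = t.
Proof.
move=> tn; rewrite /active card_imset; last exact: perm_inj.
have inj_w : injective (widen_ord tn) by move=> i j /(congr1 val) /= /val_inj.
rewrite -{2}(card_ord t) -(card_imset _ inj_w).
apply: eq_card => i; apply/idP/imsetP => [|[j _ ->]]; last by rewrite inE; exact: ltn_ord j.
rewrite inE => it.
by exists (Ordinal (it : (i < t)%N)) => //; apply: val_inj.
Qed.

Lemma active_subset (s : 'S_n) t u : (t <= u)%N -> active s t \subset active s u.
Proof.
move=> tu; apply/subsetP=> _ /imsetP[i it ->].
by apply: imset_f; move: it; rewrite !inE => /leq_trans; apply.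
Qed.

Lemma active0 (s : 'S_n) : active s 0 = set0.
Proof. by apply/setP=> v; rewrite inE; apply/imsetP=> -[i]; rewrite inE. Qed.

Lemma active_eq (s s' : 'S_n) t :
  (forall i : 'I_n, (i < t)%N -> s i = s' i) -> active s t = active s' t.
Proof. by move=> ss'; apply: eq_in_imset => i; rewrite inE => /ss'. Qed.

Lemma activeS (s : 'S_n) (i : 'I_n) : active s i.+1 = s i |: active s i.
Proof.
apply/setP=> v; rewrite inE in_set1; apply/imsetP/orP.
  case=> j; rewrite inE ltnS leq_eqVlt => /orP[/eqP/val_inj ->|ji] ->.
    by left.
  by right; apply: imset_f; rewrite inE.
case=> [/eqP->|/imsetP[j]]; first by exists i; rewrite // inE.
by rewrite inE => ji ->; exists j => //; rewrite inE ltnS ltnW.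
Qed.

Lemma mem_active (s : 'S_n) t (i : 'I_n) : (s i \in active s t) = (i < t)%N.
Proof. by rewrite mem_imset ?inE //; exact: perm_inj. Qed.

(* Averaging over the transpositions of position [i] with the positions [j >= i]
   makes the vertex activated at time [i] uniform among the inactive ones. *)
Lemma submartingale_step T Phi (P : pred 'S_n) (i : 'I_n) :
  submartingale T Phi -> (i < T)%N ->
  (forall s s' : 'S_n, (forall j : 'I_n, (j < i)%N -> s j = s' j) -> P s -> P s') ->
  \sum_(s | P s) Phi (active s i) <= \sum_(s | P s) Phi (active s i.+1).
Proof.
move=> subPhi iT Pdet.
have fixlow (j l : 'I_n) (s : 'S_n) : (i <= j)%N -> (l < i)%N ->
    (tperm i j * s)%g l = s l.
  move=> ij li; rewrite permM tpermD //; apply/eqP=> E; move: li; rewrite -E ?ltnn //.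
  by rewrite ltnNge ij.
have swap (j : 'I_n) : (i <= j)%N ->
    \sum_(s | P s) Phi (active s i.+1) = \sum_(s | P s) Phi (s j |: active s i).
  move=> ij; rewrite (reindex_inj (mulgI (tperm i j))) /=.
  apply: eq_big => s.
    apply/idP/idP; apply: Pdet => l li; first by rewrite fixlow.
    by rewrite fixlow.
  move=> _; rewrite activeS permM tpermL; congr (Phi (_ |: _)).
  by apply: active_eq => l li; rewrite fixlow.
have cardge : #|[pred j : 'I_n | (i <= j)%N]| = (n - i)%N.
  have := cardC (fun j : 'I_n => (j < i)%N).
  have -> : #|(fun j : 'I_n => (j < i)%N)| = i.
    rewrite -[RHS](card_active 1 (ltnW (ltn_ord i))) card_imset; last exact: perm_inj.
    by apply: eq_card => j; rewrite inE.
  rewrite card_ord => E.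
  have -> : #|[pred j : 'I_n | (i <= j)%N]| = #|[predC (fun j : 'I_n => (j < i)%N)]|.
    by apply: eq_card => j; rewrite !inE -leqNgt.
  by apply: (@addnI i); rewrite subnKC // ltnW.
have ni : 0 < (n - i)%:R :> R by rewrite ltr0n subn_gt0.
have avg : (n - i)%:R * \sum_(s | P s) Phi (active s i.+1) =
    \sum_(j : 'I_n | (i <= j)%N) \sum_(s | P s) Phi (s j |: active s i).
  by rewrite mulr_natl -cardge -sumr_const; apply: eq_bigr => j; exact: swap.
rewrite -(ler_pM2l ni) avg exchange_big mulr_sumr.
apply: ler_sum => s _.
have := subPhi (active s i); rewrite card_active; last exact: ltnW.
move=> /(_ iT) /le_trans; apply.
(* The positions [j >= i] carry exactly the vertices inactive at time [i]. *)
rewrite (reindex_inj (@perm_inj _ s)) /=.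
rewrite le_eqVlt; apply/orP; left; apply/eqP/eq_bigl => j.
by rewrite inE mem_active -leqNgt.
Qed.

(** The time [maxn (minn (A s) T) t] moves from [minn (A s) T] to [T] as [t] grows from 0 to [T].
    Raising [t] by one affects only the runs with [A s <= t], an event determined by the first [t]
    positions. *)
Lemma optional_stopping T Phi (A : {ffun 'S_n -> 'I_n.+1}) :
  (T <= n)%N -> stopping_algorithm A -> submartingale T Phi ->
  mean (fun s => Phi (active s (minn (A s) T))) <= mean (fun s => Phi (active s T)).
Proof.
move=> Tn /forallP stopA subPhi.
have step t : (t < T)%N ->
    \sum_s Phi (active s (maxn (minn (A s) T) t)) <=
    \sum_s Phi (active s (maxn (minn (A s) T) t.+1)).
  move=> tT; pose i := Ordinal (leq_trans tT Tn).
  rewrite (bigID (fun s => A s <= t)%N) [leRHS](bigID (fun s => A s <= t)%N) /=.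
  apply: lerD; last first.
    rewrite le_eqVlt; apply/orP; left; apply/eqP/eq_bigr => s.
    rewrite -ltnNge => tA; congr (Phi (active s _)); lia.
  have -> : \sum_(s | (A s <= t)%N) Phi (active s (maxn (minn (A s) T) t)) =
            \sum_(s | (A s <= t)%N) Phi (active s i).
    by apply: eq_bigr => s At; congr (Phi (active s _)); rewrite /=; lia.
  have -> : \sum_(s | (A s <= t)%N) Phi (active s (maxn (minn (A s) T) t.+1)) =
            \sum_(s | (A s <= t)%N) Phi (active s i.+1).
    by apply: eq_bigr => s At; congr (Phi (active s _)); rewrite /=; lia.
  apply: (submartingale_step subPhi) => // s s' ss' At.
  have /forallP /(_ s') /implyP := stopA s.
  suff H : [forall j : 'I_n, (j < A s)%N ==> (s j == s' j)] by move=> /(_ H) /eqP ->.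
  by apply/forallP=> j; apply/implyP=> jA; apply/eqP/ss'; exact: leq_trans jA At.
have mono t : (t <= T)%N -> \sum_s Phi (active s (minn (A s) T)) <=
    \sum_s Phi (active s (maxn (minn (A s) T) t)).
  elim: t => [_|t IH tT]; first by under [leRHS]eq_bigr do rewrite maxn0.
  by apply: le_trans (IH (ltnW tT)) (step t tT).
rewrite /mean ler_wpM2l ?invr_ge0 ?ler0n //.
apply: le_trans (mono T (leqnn T)) _.
rewrite le_eqVlt; apply/orP; left; apply/eqP/eq_bigr => s _.
by congr (Phi (active s _)); lia.
Qed.

Lemma martingale_sub T Phi : martingale T Phi -> submartingale T Phi.
Proof. by move=> mPhi S ST; rewrite mPhi. Qed.

Lemma martingaleZ T c Phi : martingale T Phi -> martingale T (fun S => c * Phi S).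
Proof. by move=> mPhi S ST; rewrite mulrCA mPhi // mulr_sumr. Qed.

Lemma martingaleB T Phi Psi :
  martingale T Phi -> martingale T Psi -> martingale T (fun S => Phi S - Psi S).
Proof.
move=> mPhi mPsi S ST.
by rewrite mulrBr mPhi // mPsi // -sumrB.
Qed.

Lemma martingale_sum T (I : Type) (r : seq I) (P : pred I) (F : I -> {set 'I_n} -> R) :
  (forall i, P i -> martingale T (F i)) ->
  martingale T (fun S => \sum_(i <- r | P i) F i S).
Proof.
move=> mF S ST; rewrite mulr_sumr exchange_big.
by apply: eq_bigr => i /mF ->.
Qed.

Lemma martingale_norm T Phi : martingale T Phi -> submartingale T (fun S => `|Phi S|).
Proof.
move=> mPhi S ST; rewrite -[_%:R]ger0_norm ?ler0n // -normrM mPhi //.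
exact: ler_norm_sum.
Qed.

(** Optional stopping for [Phi] and for its negative gives every algorithm the same mean; stopping
    at time 0 identifies it. *)
Lemma mean_martingale T Phi (A : {ffun 'S_n -> 'I_n.+1}) :
  (T <= n)%N -> stopping_algorithm A -> martingale T Phi ->
  mean (fun s => Phi (active s (minn (A s) T))) = Phi set0.
Proof.
move=> Tn stopA mPhi.
have terminal (A' : {ffun 'S_n -> 'I_n.+1}) : stopping_algorithm A' ->
    mean (fun s => Phi (active s (minn (A' s) T))) = mean (fun s => Phi (active s T)).
  move=> stopA'; apply/le_anti; rewrite optional_stopping //=; last exact: martingale_sub.
  have /(optional_stopping Tn stopA') := martingale_sub (martingaleZ (-1) mPhi).
  by rewrite !meanZ ler_nM2l ?ltrN10.
have stop0 : stopping_algorithm [ffun=> ord0 : 'I_n.+1].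
  by apply/forallP=> s; apply/forallP=> s'; rewrite !ffunE eqxx implybT.
rewrite terminal // -(terminal _ stop0) -[RHS](mean_const n).
by apply: eq_mean => s; rewrite ffunE min0n active0.
Qed.

(** At time [t] the set [C] is inactive with probability [(n - t) ^_ #|C| / n ^_ #|C|]; dividing the
    indicator by the numerator makes the mean constant in time. *)
Definition inactive_mart (C S : {set 'I_n}) : R :=
  [disjoint C & S]%:R / ((n - #|S|) ^_ #|C|)%:R.

(** With [d.+1] inactive vertices, [d.+1 - #|C|] choices of the next one keep [C] inactive. The two
    sides then agree because [d.+1 ^_ #|C|.+1] can be expanded from either end. *)
Lemma inactive_martingale T (C : {set 'I_n}) :
  (T + #|C| <= n)%N -> martingale T (inactive_mart C).
Proof.
move=> TC S ST; rewrite /inactive_mart.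
have [d dE] : exists d, (n - #|S| = d.+1)%N by exists (n - #|S|).-1; lia.
have cardU v : v \in ~: S -> (n - #|v |: S|)%N = d.
  by rewrite inE cardsU1 => ->; lia.
rewrite dE; under eq_bigr => v vS do rewrite cardU //.
rewrite -mulr_suml; have [CS|/negbTE CS] := boolP [disjoint C & S]; last first.
  rewrite big1 ?mul0r ?mulr0 // => v vS.
  apply/eqP; rewrite pnatr_eq0 eqb0; apply: contraFN CS.
  by apply: disjointWr; exact: subsetUr.
have -> : \sum_(v in ~: S) [disjoint C & v |: S]%:R = (d.+1 - #|C|)%:R :> R.
  transitivity (\sum_(v in ~: S :\: C) 1 : R).
    rewrite [LHS]big_mkcond [RHS]big_mkcond; apply: eq_bigr => v _.
    rewrite in_setD andbC; case: ifP => //= vS.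
    rewrite disjoint_sym disjointsU disjoints1 [X in _ && X]disjoint_sym CS andbT.
    by case: (v \in C).
  rewrite sumr_const; congr (_%:R).
  rewrite cardsD (setIidPr _); last by rewrite -disjoints_subset.
  by rewrite cardsCs setCK card_ord dE.
have Cd : (#|C| <= d)%N by lia.
have fne m : (#|C| <= m)%N -> (m ^_ #|C|)%:R != 0 :> R.
  by move=> Cm; rewrite pnatr_eq0 -lt0n ffact_gt0.
rewrite mul1r; apply/eqP; rewrite eqr_div ?fne //; last by lia.
by rewrite -!natrM -ffactSS ffactnSr mulnC.
Qed.

(** The constant time [T] is a stopping algorithm, so the probability is read off from the initial
    value of [inactive_mart]. *)
Lemma mean_inactive T (D : {set 'I_n}) : (T + #|D| <= n)%N ->
  mean (fun s => [disjoint D & active s T]%:R) =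
  ((n - T) ^_ #|D|)%:R / (n ^_ #|D|)%:R :> R.
Proof.
move=> TD; have Tn : (T <= n)%N by lia.
have stopT : stopping_algorithm [ffun=> inord T : 'I_n.+1].
  by apply/forallP=> s; apply/forallP=> s'; rewrite !ffunE eqxx implybT.
have := mean_martingale Tn stopT (inactive_martingale TD).
rewrite /inactive_mart disjoints_subset setC0 subsetT cards0 subn0 mul1r => E.
have fne : ((n - T) ^_ #|D|)%:R != 0 :> R.
  by rewrite pnatr_eq0 -lt0n ffact_gt0; lia.
rewrite -E -meanZ; apply: eq_mean => s.
by rewrite ffunE inordK ?ltnS // minnn card_active // mulrC divfK.
Qed.

End OptionalStopping.

(** * Bounds on powers and falling factorials *)

Section Estimates.
Variable R : realFieldType.

(** AM-GM for [k * x] and [k] copies of [z], whose sum is [k * (x + z)]. For [x = p] and [z = 1 - p]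
    the constant is the maximum of [p * (1 - p) ^ k], attained at [p = 1 / k.+1]. *)
Lemma mulr_exp_le_max (k : nat) (x z : R) : (0 < k)%N -> 0 <= x -> 0 <= z ->
  x * z ^+ k <= k%:R ^+ k / k.+1%:R ^+ k.+1 * (x + z) ^+ k.+1.
Proof.
move=> k0 x0 z0; have k0R : 0 < k%:R :> R by rewrite ltr0n.
pose E (i : 'I_k.+1) := if i == ord0 then k%:R * x else z.
have E0 i : 0 <= E i by rewrite /E; case: ifP => _ //; rewrite mulr_ge0 // ltW.
have := (leif_AGM (A := 'I_k.+1) (E := E) (fun i _ => E0 i)).1.
rewrite card_ord !big_ord_recl /= /E eqxx sumr_const prodr_const card_ord /=.
have -> : k%:R * x + z *+ k = k%:R * (x + z) by rewrite -mulr_natl; ring.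
rewrite !exprMn exprVn exprS -!mulrA ler_pM2l // => /le_trans; apply.
by rewrite le_eqVlt; apply/orP; left; apply/eqP; ring.
Qed.

Lemma leq_ffact n m j : (m <= n)%N -> (m ^_ j <= n ^_ j)%N.
Proof.
by move=> mn; rewrite !ffact_prod; apply: leq_prod => i _; rewrite leq_sub2r.
Qed.

Lemma ffact_le_exp n j : (n ^_ j <= n ^ j)%N.
Proof.
rewrite ffact_prod -[j in leqRHS]card_ord -prod_nat_const.
by apply: leq_prod => i _; rewrite leq_subr.
Qed.

Lemma exp_le_ffact n j : ((n - j.-1) ^ j <= n ^_ j)%N.
Proof.
rewrite ffact_prod -[j in leqLHS]card_ord -prod_nat_const card_ord.
by apply: leq_prod => i _; rewrite leq_sub2l //; have := ltn_ord i; lia.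
Qed.

(** In the induction the new factor [n - j.+1] costs at most [j.+1 * n ^ j.+1]; the coefficient
    [j * j.+1] leaves room for this. *)
Lemma expn_le_ffact (n j : nat) :
  (n ^ j.+1 <= n ^_ j.+1 + j * j.+1 * n ^ j)%N.
Proof.
elim: j => [|j IH]; first by rewrite ffactn1 expn1 leq_addr.
have := ffactnSr n j.+1; set F := (n ^_ _)%N in IH *; set F' := (n ^_ _)%N => F'E.
have Fle : (F <= n ^ j.+1)%N by exact: ffact_le_exp.
have nF : (n * F <= F' + j.+1 * n ^ j.+1)%N.
  apply: leq_trans (_ : F' + j.+1 * F <= _)%N; last by rewrite leq_add2l leq_mul2l Fle orbT.
  rewrite F'E [(n * F)%N]mulnC [(j.+1 * F)%N]mulnC -mulnDr leq_mul2l.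
  by apply/orP; right; lia.
rewrite [(n ^ j.+2)%N]expnS.
apply: leq_trans (leq_mul (leqnn n) IH) _.
rewrite mulnDr mulnCA -expnS; nia.
Qed.

Lemma ffact_le_max (k n t : nat) : (0 < k)%N -> (t <= n)%N -> (k < n)%N ->
  (t * (n - t) ^_ k)%:R <=
  (k%:R ^+ k / k.+1%:R ^+ k.+1 + (k * k.+1)%:R / n%:R) * (n ^_ k.+1)%:R :> R.
Proof.
move=> k0 tn kn; set c := _ / _.
have n0 : (0 < n)%N by lia.
set F := (n ^_ _)%:R; set y := (t * _)%:R; set K := (k * k.+1)%:R.
have yY : y <= c * n%:R ^+ k.+1.
  rewrite /y natrM; apply: le_trans (_ : t%:R * (n - t)%:R ^+ k <= _).
    by rewrite ler_wpM2l // -natrX ler_nat ffact_le_exp.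
  apply: le_trans (mulr_exp_le_max k0 _ _) _ => //.
  by rewrite -natrD subnKC.
have yF : y <= F.
  rewrite ler_nat; case: t tn {yY y} => [|t] tn; first by [].
  rewrite ffactnS.
  by apply: leq_mul => //; rewrite leq_ffact //; lia.
have NF : n%:R ^+ k.+1 <= F + K * n%:R ^+ k.
  by rewrite -!natrX -natrM -natrD ler_nat expn_le_ffact.
have n0R : 0 < n%:R :> R by rewrite ltr0n.
have N0 : 0 < n%:R ^+ k :> R by rewrite exprn_gt0.
have y0 : 0 <= y by rewrite ler0n.
have F0 : 0 <= F by rewrite ler0n.
have K0 : 0 <= K by rewrite ler0n.
(* After multiplication by [n ^ k.+1], [yY] is used against the main term [F] of [NF] and [yF]
   against its error term, which leaves the relative error [K / n]. *)
rewrite -(ler_pM2r (mulr_gt0 N0 n0R)).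
apply: le_trans (_ : y * (F + K * n%:R ^+ k) <= _).
  by rewrite ler_wpM2l // -exprSr.
rewrite mulrDr.
apply: le_trans (_ : c * n%:R ^+ k.+1 * F + F * (K * n%:R ^+ k) <= _).
  by apply: lerD; rewrite ler_wpM2r // mulr_ge0 // ltW.
rewrite le_eqVlt; apply/orP; left; apply/eqP.
by rewrite exprSr; field; rewrite gt_eqF.
Qed.
End Estimates.

(** * Second moment at a deterministic time *)

Section Concentration.
Variables (R : realType) (n k T m : nat).
Variables (V : {set 'I_n}) (B : 'I_n -> {set 'I_n}) (r : 'I_n -> nat).
Hypothesis nTm : n = (T + m)%N.
Hypothesis km : (k.+1.*2 <= m)%N.
Hypothesis r_inj : injective r.
Hypothesis cardB : forall v, v \in V -> #|B v| = k.
Hypothesis B_earlier : forall v u, v \in V -> u \in B v -> (r u < r v)%N.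

Let idle (C S : {set 'I_n}) : R := [disjoint C & S]%:R.
(** At time [T], with [m] vertices inactive, this is [m ^_ k.+1] times the summand at [v] of the
    martingale [Q] defined below. *)
Let defect v S : R := (m - k)%:R * idle (B v) S - (n - k)%:R * idle (v |: B v) S.

Let idle_ge0 C S : 0 <= idle C S.
Proof. exact: ler0n. Qed.

Let idle_le1 C S : idle C S <= 1.
Proof. by rewrite /idle; case: [disjoint _ & _]. Qed.

Let idleM C D S : idle C S * idle D S = idle (C :|: D) S.
Proof. by rewrite /idle disjointsU -natrM mulnb. Qed.

Let notin_B v : v \in V -> v \notin B v.
Proof. by move=> vV; apply/negP=> /(B_earlier vV); rewrite ltnn. Qed.

(* The covariance of [defect v] with an event not involving [v] is small because
   [v] is nearly uniformly distributed given the status of [B v] and [C]. *)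
Lemma mean_defect_idle v (C : {set 'I_n}) : v \in V -> v \notin C -> (#|C| <= k.+1)%N ->
  `|mean (fun s => defect v (active s T) * idle C (active s T))| <= (k.+1.*2)%:R.
Proof.
move=> vV vC Ck; set D := B v :|: C.
have vD : v \notin D by rewrite inE negb_or notin_B.
pose u := #|D|; have ku : (k <= u)%N.
  by rewrite -(cardB vV) subset_leq_card // subsetUl.
(* Together with [km] this makes [D] and [v |: D] small enough for [mean_inactive]. *)
have uk : (u <= k + k.+1)%N.
  by rewrite /u /D cardsU (cardB vV); lia.
have -> : mean (fun s => defect v (active s T) * idle C (active s T)) =
    (m - k)%:R * mean (fun s => idle D (active s T)) -
    (n - k)%:R * mean (fun s => idle (v |: D) (active s T)).
  rewrite -mulNr -!meanZ -meanD; apply: eq_mean => s.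
  by rewrite /defect mulrBl -!mulrA !idleM /D setUA mulNr.
have cardvD : #|v |: D| = u.+1 by rewrite cardsU1 vD.
rewrite !mean_inactive ?cardvD; [|lia|lia].
have -> : (n - T = m)%N by lia.
rewrite -/u !ffactnSr !natrM.
have nu0 : (n - u)%:R != 0 :> R by rewrite pnatr_eq0; lia.
have f0 : 0 < (n ^_ u)%:R :> R by rewrite ltr0n ffact_gt0; lia.
set P := (m ^_ u)%:R / (n ^_ u)%:R.
have P0 : 0 <= P by rewrite divr_ge0 ?ler0n.
have P1 : P <= 1 by rewrite ler_pdivrMr // mul1r ler_nat leq_ffact; lia.
(* The cancellation is [(m - k) * (n - u) - (n - k) * (m - u) = (n - m) * (u - k)]. *)
have -> : (m - k)%:R * P - (n - k)%:R *
   ((m ^_ u)%:R * (m - u)%:R / ((n ^_ u)%:R * (n - u)%:R)) =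
   P * ((T * (u - k))%:R / (n - u)%:R).
  rewrite !natrM !natrB; try lia.
  have -> : T%:R = n%:R - m%:R :> R by rewrite nTm natrD addrK.
  rewrite /P; field; rewrite -natrB; last by lia.
  by rewrite nu0 gt_eqF.
rewrite ger0_norm; last by rewrite mulr_ge0 // divr_ge0 ?ler0n.
rewrite -[leRHS]mul1r; apply: ler_pM => //; first by rewrite divr_ge0 ?ler0n.
rewrite ler_pdivrMr ?ltr0n; last by lia.
rewrite -natrM ler_nat -doubleMl doubleMr mulnC.
apply: leq_mul; lia.
Qed.

(** By symmetry [v] is the later vertex. Then neither event in [defect w] involves [v], and
    [mean_defect_idle] applies to both, with weights at most [n]. *)
Lemma mean_defect_cross v w : v \in V -> w \in V -> v != w ->
  mean (fun s => defect v (active s T) * defect w (active s T)) <= (4 * k.+1 * n)%:R.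
Proof.
wlog rwv : v w / (r w < r v)%N => [H vV wV vw|vV wV vw].
  case: (ltngtP (r w) (r v)) => [lt|lt|/r_inj E]; first exact: H.
    rewrite (eq_mean (g := fun s => defect w (active s T) * defect v (active s T))).
      by apply: H => //; rewrite eq_sym.
    by move=> s; rewrite mulrC.
  by rewrite E eqxx in vw.
have vB : v \notin B w.
  by apply/negP=> /(B_earlier wV) /(ltn_trans rwv); rewrite ltnn.
have vwB : v \notin w |: B w by rewrite !inE negb_or vw.
rewrite (eq_mean (g := fun s =>
  (m - k)%:R * (defect v (active s T) * idle (B w) (active s T)) +
  - (n - k)%:R * (defect v (active s T) * idle (w |: B w) (active s T)))); last first.
  by move=> s; rewrite {2}/defect; ring.
rewrite meanD !meanZ.
apply: le_trans (ler_norm _) _; apply: le_trans (ler_normD _ _) _.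
rewrite (normrM (m - k)%:R) (normrM (- _)) normrN !normr_nat.
apply: le_trans (_ : n%:R * k.+1.*2%:R + n%:R * k.+1.*2%:R <= _).
  apply: lerD; apply: ler_pM => //; rewrite ?ler_nat; try lia.
    by apply: mean_defect_idle => //; rewrite (cardB wV).
  by apply: mean_defect_idle => //; rewrite cardsU1 notin_B // (cardB wV).
by rewrite -!natrM -natrD ler_nat; lia.
Qed.

Let norm_defect v S : `|defect v S| <= n%:R.
Proof.
have := idle_ge0 (B v) S; have := idle_le1 (B v) S.
have := idle_ge0 (v |: B v) S; have := idle_le1 (v |: B v) S.
rewrite /defect; move: (idle _ _) (idle _ _) => x y x1 x0 y1 y0.
have a : (m - k)%:R <= n%:R :> R by rewrite ler_nat; lia.
have b : (n - k)%:R <= n%:R :> R by rewrite ler_nat; lia.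
have a0 : 0 <= (m - k)%:R :> R by rewrite ler0n.
have b0 : 0 <= (n - k)%:R :> R by rewrite ler0n.
by rewrite ler_norml; apply/andP; split; nra.
Qed.

(** Each [v] contributes at most [n ^ 2] on the diagonal and [4 * k.+1 * n] for each of at most [n]
    other vertices. This gains a factor [n] over the trivial order [n ^ 4]. *)
Lemma mean_sum_defect_sqr :
  mean (fun s => (\sum_(v in V) defect v (active s T)) ^+ 2) <=
  ((4 * k + 5) * n ^ 3)%:R.
Proof.
rewrite (eq_mean (g := fun s => \sum_(v in V) \sum_(w in V)
   defect v (active s T) * defect w (active s T))); last first.
  by move=> s; rewrite expr2 mulr_suml; apply: eq_bigr => v _; rewrite mulr_sumr.
rewrite mean_sum.
have Vn : (#|V| <= n)%N by rewrite -[leqRHS]card_ord max_card.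
apply: le_trans (_ : \sum_(v in V) ((4 * k + 5) * n ^ 2)%:R <= _); last first.
  rewrite sumr_const -mulrnA ler_nat.
  by rewrite [(n ^ 3)%N]expnSr mulnA leq_mul.
apply: ler_sum => v vV; rewrite mean_sum (bigD1 v) //=.
apply: le_trans (_ : (n ^ 2)%:R + \sum_(w in V | w != v) (4 * k.+1 * n)%:R <= _).
  apply: lerD.
    rewrite -[leRHS](mean_const n); apply: ler_mean => s.
    by rewrite -expr2 -real_normK ?num_real // natrX lerXn2r ?nnegrE ?ler0n.
  by apply: ler_sum => w /andP[wV wv]; apply: mean_defect_cross; rewrite // eq_sym.
rewrite sumr_const -mulrnA -natrD ler_nat.
set c := #|_|; have cn : (c <= n)%N by rewrite -[leqRHS]card_ord max_card.
nia.
Qed.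

(** The inequality [|x| <= x ^ 2 / l + l] with [l = delta * n ^ 2] replaces Cauchy-Schwarz and
    avoids square roots. *)
Lemma mean_norm_sum_defect (delta : R) : 0 < delta ->
  mean (fun s => `|\sum_(v in V) defect v (active s T)|) <=
  (4 * k + 5)%:R * n%:R / delta + delta * n%:R ^+ 2.
Proof.
move=> d0; have n0 : 0 < n%:R :> R by rewrite ltr0n; lia.
have l0 : 0 < delta * n%:R ^+ 2 by rewrite mulr_gt0 // exprn_gt0.
set l := _ * _ in l0 *.
apply: le_trans (_ : mean (fun s =>
    l^-1 * (\sum_(v in V) defect v (active s T)) ^+ 2 + l) <= _).
  apply: ler_mean => s; set x := \sum_(v in V) _.
  rewrite -(ler_pM2l l0) mulrDr mulVKf ?gt_eqF // -[x ^+ 2]real_normK ?num_real //.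
  by have := normr_ge0 x; nra.
rewrite meanD mean_const meanZ lerD2r.
apply: le_trans (ler_wpM2l _ mean_sum_defect_sqr) _; first by rewrite invr_ge0 ltW.
rewrite le_eqVlt; apply/orP; left; apply/eqP.
by rewrite /l natrM natrX; field; rewrite !gt_eqF.
Qed.

End Concentration.

(** * The count under a stopping algorithm *)

Section StoppedCount.
Variables (R : realType) (n k T m : nat).
Variables (V : {set 'I_n}) (B : 'I_n -> {set 'I_n}) (r : 'I_n -> nat).
Hypothesis k_gt0 : (0 < k)%N.
Hypothesis nTm : n = (T + m)%N.
Hypothesis km : (k.+1.*2 <= m)%N.
Hypothesis r_inj : injective r.
Hypothesis cardB : forall v, v \in V -> #|B v| = k.
Hypothesis B_earlier : forall v u, v \in V -> u \in B v -> (r u < r v)%N.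

Let idle (C S : {set 'I_n}) : R := [disjoint C & S]%:R.
Let X (S : {set 'I_n}) : R := \sum_(v in V) (idle (B v) S - idle (v |: B v) S).
(** The factor [n - k] makes [Q] vanish on [set0], since [n ^_ k.+1 = n ^_ k * (n - k)]. *)
Let Q (S : {set 'I_n}) : R := \sum_(v in V)
  (inactive_mart R (B v) S - (n - k)%:R * inactive_mart R (v |: B v) S).
Let c : R := k%:R ^+ k / k.+1%:R ^+ k.+1.
Let cc : R := c + (k * k.+1)%:R / n%:R.

Let Tn : (T <= n)%N. Proof. by lia. Qed.

Let cardVn : (#|V| <= n)%N.
Proof. by rewrite -[leqRHS]card_ord max_card. Qed.

Let cardvB v : v \in V -> #|v |: B v| = k.+1.
Proof.
move=> vV; rewrite cardsU1 (cardB vV).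
by case: (boolP (v \in B v)) => // /(B_earlier vV); rewrite ltnn.
Qed.

Let ffact_neq0 a j : (j <= a)%N -> (a ^_ j)%:R != 0 :> R.
Proof. by move=> ja; rewrite pnatr_eq0 -lt0n ffact_gt0. Qed.

Let c_ge0 : 0 <= c.
Proof. by rewrite divr_ge0 // exprn_ge0 // ler0n. Qed.

Let cc_ge0 : 0 <= cc.
Proof. by rewrite addr_ge0 // divr_ge0 // ler0n. Qed.

Lemma countE (S : {set 'I_n}) :
  #|[set v in V | (v \in S) && [disjoint B v & S]]|%:R = X S.
Proof.
rewrite -sum1_card natr_sum /X [LHS]big_mkcond [RHS]big_mkcond.
apply: eq_bigr => v _; rewrite in_set; case: (v \in V) => //=.
rewrite /idle disjointsU disjoints1.
by case: (v \in S); case: [disjoint _ & _] => /=; rewrite ?subrr ?subr0.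
Qed.

Let X_ge0 S : 0 <= X S.
Proof. by rewrite -countE ler0n. Qed.

Let X_le_idle S : X S <= \sum_(v in V) idle (B v) S.
Proof. by apply: ler_sum => v _; rewrite gerBl ler0n. Qed.

Lemma Q_martingale : martingale T Q.
Proof.
apply: martingale_sum => v vV; apply: martingaleB.
  by apply: inactive_martingale; rewrite cardB //; lia.
apply: martingaleZ; apply: inactive_martingale; rewrite cardvB //; lia.
Qed.

(** The coefficients of the exact decomposition are bounded uniformly in the time, so that the
    right-hand side is a constant combination of a martingale and a submartingale. *)
Lemma count_le (S : {set 'I_n}) : (#|S| <= T)%N ->
  X S <= cc * (n ^_ k)%:R * \sum_(v in V) inactive_mart R (B v) S
         + (n ^_ k)%:R * `|Q S|.
Proof.
move=> ST; set t := #|S|.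
have nk0 : 0 < (n - k)%:R :> R by rewrite ltr0n; lia.
(* The indicator of [B v] gets the coefficient [(t + (n - t - k)) / (n - k) = 1]. *)
have -> : X S = (t * (n - t) ^_ k)%:R / (n - k)%:R *
      \sum_(v in V) inactive_mart R (B v) S +
    ((n - t) ^_ k.+1)%:R / (n - k)%:R * Q S.
  rewrite !mulr_sumr -big_split; apply: eq_bigr => v vV.
  rewrite /inactive_mart (cardB vV) (cardvB vV) -/t -/(idle _ _) -/(idle _ _).
  rewrite /= !ffactnSr !natrM.
  have f0 : ((n - t) ^_ k)%:R != 0 :> R by apply: ffact_neq0; lia.
  have p0 : (n - t - k)%:R != 0 :> R by rewrite pnatr_eq0; lia.
  have nkE : (n - k)%:R = (n - t - k)%:R + t%:R :> R.
    by rewrite -natrD; congr (_%:R); lia.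
  have := gt_eqF nk0; rewrite nkE => /negbT pt0.
  by field; rewrite f0 p0 pt0.
apply: lerD.
  rewrite ler_wpM2r //.
    by apply: sumr_ge0 => v _; rewrite divr_ge0 ?ler0n.
  rewrite ler_pdivrMr // -mulrA -natrM -ffactnSr.
  by apply: ffact_le_max => //; lia.
apply: le_trans (_ : ((n - t) ^_ k.+1)%:R / (n - k)%:R * `|Q S| <= _).
  by rewrite ler_wpM2l ?ler_norm // divr_ge0 ?ler0n.
rewrite ler_wpM2r // ler_pdivrMr // -natrM -ffactnSr ler_nat leq_ffact //.
by lia.
Qed.

(** The terms [c * n] and [k * k.+1] come from the martingale part of [count_le], [m] from stopping
    after [T], and the rest from the mean of [|Q|] at time [T]. *)
Lemma mean_stopped_count (A : {ffun 'S_n -> 'I_n.+1}) (delta : R) :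
  stopping_algorithm A -> 0 < delta ->
  mean (fun s => X (active s (A s))) <=
  c * n%:R + (k * k.+1)%:R + m%:R + n%:R ^+ k / (m - k)%:R ^+ k.+1 *
    ((4 * k + 5)%:R * n%:R / delta + delta * n%:R ^+ 2).
Proof.
move=> stopA d0.
have n0 : 0 < n%:R :> R by rewrite ltr0n; lia.
(* After time [T] the count is at most the number of sets [B v] still inactive at [T], since a set
   inactive later was inactive then. *)
have split_T s : X (active s (A s)) <=
    X (active s (minn (A s) T)) + \sum_(v in V) idle (B v) (active s T).
  have sum_ge0 : 0 <= \sum_(v in V) idle (B v) (active s T).
    by apply: sumr_ge0 => v _; rewrite ler0n.
  case: (leqP (A s) T) => AT; first by rewrite lerDl.
  apply: le_trans (X_le_idle _) _; rewrite -[leLHS]add0r lerD //.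
  apply: ler_sum => v _; rewrite ler_nat.
  case: (boolP [disjoint B v & active s (A s)]) => // disj.
  by rewrite (disjointWr _ disj) // active_subset // ltnW.
apply: le_trans (ler_mean split_T) _; rewrite meanD.
(* The probability [m ^_ k / n ^_ k] that [B v] is inactive at [T] is at most [m / n] because
   [k >= 1]. *)
have tail : mean (fun s => \sum_(v in V) idle (B v) (active s T)) <= m%:R.
  rewrite mean_sum; apply: le_trans (_ : \sum_(v in V) m%:R / n%:R <= _).
    apply: ler_sum => v vV; rewrite mean_inactive cardB //; last by lia.
    have -> : (n - T = m)%N by lia.
    have f0 : 0 < (n ^_ k)%:R :> R by rewrite ltr0n ffact_gt0; lia.
    rewrite ler_pdivrMr // mulrAC ler_pdivlMr // -!natrM ler_nat.
    rewrite -(ltn_predK k_gt0) !ffactnS mulnAC -mulnA leq_mul2l [(n * _)%N]mulnC.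
    by rewrite [leqRHS]mulnC leq_mul2r leq_ffact ?orbT //; lia.
  rewrite sumr_const -[leLHS]mulr_natl mulrCA -[leRHS]mulr1 ler_wpM2l //.
  by rewrite ler_pdivrMr // mul1r ler_nat.
have meanQ : (n ^_ k)%:R * mean (fun s => `|Q (active s T)|) <=
    n%:R ^+ k / (m - k)%:R ^+ k.+1 *
    ((4 * k + 5)%:R * n%:R / delta + delta * n%:R ^+ 2).
  have f0 : 0 < (m ^_ k.+1)%:R :> R by rewrite ltr0n ffact_gt0; lia.
  have mk0 : 0 < (m - k)%:R ^+ k.+1 :> R by rewrite exprn_gt0 // ltr0n; lia.
  have QE s : `|Q (active s T)| = (m ^_ k.+1)%:R^-1 *
      `|\sum_(v in V) ((m - k)%:R * idle (B v) (active s T)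
                       - (n - k)%:R * idle (v |: B v) (active s T))|.
    rewrite -[X in X * _]ger0_norm ?invr_ge0 ?ltW // -normrM mulr_sumr.
    congr `|_|; apply: eq_bigr => v vV.
    rewrite /inactive_mart (cardB vV) (cardvB vV) card_active //.
    have -> : (n - T = m)%N by lia.
    rewrite ffactnSr natrM -/(idle _ _) -/(idle _ _).
    have fm0 : (m ^_ k)%:R != 0 :> R by apply: ffact_neq0; lia.
    have p0 : (m - k)%:R != 0 :> R by rewrite pnatr_eq0; lia.
    by field; rewrite fm0 p0.
  rewrite (eq_mean QE) meanZ mulrA.
  have sumg := mean_norm_sum_defect nTm km r_inj cardB B_earlier d0.
  apply: ler_pM => //; first by rewrite divr_ge0 ?ler0n.
    by rewrite -(mean_const n 0); apply: ler_mean.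
  apply: ler_pM; rewrite ?invr_ge0 ?ler0n //.
    by rewrite -natrX ler_nat ffact_le_exp.
  by rewrite lef_pV2 ?posrE // -natrX ler_nat; exact: (exp_le_ffact m k.+1).
rewrite addrAC; apply: (lerD _ tail).
(* This initial value cancels the factor [n ^_ k] of [count_le], leaving at most [cc] for each
   vertex of [V]. *)
have meanM v : v \in V ->
    mean (fun s => inactive_mart R (B v) (active s (minn (A s) T))) = (n ^_ k)%:R^-1.
  move=> vV; rewrite (mean_martingale Tn stopA); last first.
    by apply: inactive_martingale; rewrite cardB //; lia.
  by rewrite /inactive_mart (cardB vV) disjoints_subset setC0 subsetT cards0 subn0 mul1r.
apply: le_trans (_ : mean (fun s =>
    cc * (n ^_ k)%:R * \sum_(v in V) inactive_mart R (B v) (active s (minn (A s) T)) +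
    (n ^_ k)%:R * `|Q (active s (minn (A s) T))|) <= _).
  by apply: ler_mean => s; apply: count_le; rewrite card_active ?geq_minr // geq_min Tn orbT.
rewrite meanD !meanZ; apply: lerD; last first.
  apply: le_trans meanQ; rewrite ler_wpM2l //.
  exact: optional_stopping Tn stopA (martingale_norm Q_martingale).
rewrite mean_sum (eq_bigr _ meanM) sumr_const -[_ *+ #|V|]mulr_natl mulrCA.
rewrite mulfK; last by apply: ffact_neq0; lia.
apply: le_trans (_ : n%:R * cc <= _); first by rewrite ler_wpM2r // ler_nat.
rewrite /cc mulrDr [n%:R * c]mulrC lerD2l mulrCA divff ?mulr1 //.
by rewrite gt_eqF.
Qed.

End StoppedCount.

(** * Choice of parameters and conclusion *)

Lemma exists_subset_card (T : finType) (A : {set T}) (k : nat) : (k <= #|A|)%N ->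
  exists2 C : {set T}, C \subset A & #|C| = k.
Proof.
move=> kA; exists [set x in take k (enum A)].
  by apply/subsetP=> x; rewrite inE => /mem_take; rewrite mem_enum.
rewrite cardsE; have /card_uniqP -> : uniq (take k (enum A)).
  by rewrite take_uniq ?enum_uniq.
by rewrite size_take -cardE; case: ltngtP kA.
Qed.

Theorem theorem4p3 (R : realType) (k : nat) (k_ge1 : (1 <= k)%N)
    (eps : R) (eps_gt0 : 0 < eps) :
  exists N : nat, forall (n : nat) (G : sgraph 'I_n),
    (N <= n)%N -> maximal_degenerate k G ->
    max_score R G <= (k%:R ^+ k / k.+1%:R ^+ k.+1 + eps) * n%:R.
Proof.
set c := _ / _.
(* The allowance [eps * n] is split into thirds: one for [m <= n / q], one for the [delta] term, one
   for the bounded terms collected in [L]. *)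
pose q := (Num.truncn (3 / eps)).+1.
have q0 : 0 < q%:R :> R by rewrite ltr0n.
have q_eps : q%:R^-1 <= eps / 3.
  rewrite -[leRHS]invf_div lef_pV2 ?posrE ?divr_gt0 //.
  by rewrite ltW // truncnS_gt.
(* [K] bounds [(n / (m - k)) ^ k.+1], by [mk2] below. *)
pose K : R := (2 * q)%:R ^+ k.+1.
have K0 : 0 < K by rewrite exprn_gt0 // ltr0n.
(* Chosen so that [K / n * (delta * n ^ 2) = eps / 3 * n]. *)
pose delta : R := eps / (3 * K).
have d0 : 0 < delta by rewrite divr_gt0 // mulr_gt0.
pose L : R := (k * k.+1)%:R + k%:R + K * (4 * k + 5)%:R / delta.
exists (maxn (2 * q * k.+1) (Num.truncn (L * 3 / eps)).+1) => n G.
rewrite geq_max => /andP[nq nL] maxG.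
have n_gt0 : (0 < n)%N by lia.
have n0 : 0 < n%:R :> R by rewrite ltr0n.
have Ln : L <= eps / 3 * n%:R.
  have : L * 3 / eps < n%:R.
    by apply: lt_le_trans (truncnS_gt _) _; rewrite ler_nat.
  by rewrite ltr_pdivrMr // => /ltW; rewrite mulrAC [eps * _]mulrC ler_pdivlMr.
have [r r_inj] := maximal_degenerate_order maxG.
set E := [set v | _] => cardE.
pose V := ~: E.
(* Outside [E] there are at least [k] earlier neighbours, and [k] of them are selected. The premise
   stands inside the existential so that [fin_all_exists] yields a total function [B]. *)
have Bex v : exists C : {set 'I_n},
    v \in V -> C \subset earlier r G v /\ #|C| = k.
  have [vE|vV] := boolP (v \in E); first by exists set0; rewrite inE vE.
  have [|C] := @exists_subset_card _ (earlier r G v) k.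
    by move: vV; rewrite inE -leqNgt.
  by exists C.
have [B BP] : exists B : 'I_n -> {set 'I_n}, forall v, v \in V ->
    B v \subset earlier r G v /\ #|B v| = k.
  exact: fin_all_exists Bex.
have cardB v : v \in V -> #|B v| = k by case/BP.
have B_earlier v u : v \in V -> u \in B v -> (r u < r v)%N.
  by case/BP=> /subsetP Bv _ /Bv; rewrite inE => /andP[].
pose m := (n %/ q)%N.
have mq_le : (m * q <= n)%N by exact: leq_trunc_div.
have mq_gt : (n < m.+1 * q)%N by exact: ltn_ceil.
have qk : (2 * q * k.+1 <= n)%N by [].
have km : (k.+1.*2 <= m)%N by rewrite leq_divRL //; lia.
have nTm : n = (n - m + m)%N by rewrite subnK // leq_div.
(* From [n < m.+1 * q] and [m.+1 <= 2 * (m - k)], the latter by [km]. *)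
have mk2 : (n <= 2 * q * (m - k))%N by nia.
have mk0 : 0 < (m - k)%:R :> R by rewrite ltr0n; lia.
(* The vertices of [E] account for at most [k] components; for the others [B v] lies in
   [earlier r G v]. *)
have CC_le (S : {set 'I_n}) : (components G S <= k +
    #|[set v in V | (v \in S) && [disjoint B v & S]]|)%N.
  apply: leq_trans (components_le G S r_inj) _.
  apply: leq_trans (_ : #|E :|: [set v in V | (v \in S) && [disjoint B v & S]]| <= _)%N.
    apply: subset_leq_card; apply/subsetP=> v; rewrite in_set => /andP[vS dv].
    rewrite in_setU; case: (boolP (v \in E)) => //= vE.
    have vV : v \in V by rewrite inE vE.
    by rewrite in_set vV vS /=; apply: disjointWl dv; case: (BP v vV).
  by apply: leq_trans (leq_card_setU _ _) _; rewrite leq_add2r.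
have score_le A : stopping_algorithm A -> score R G A <= (c + eps) * n%:R.
  move=> stopA.
  have H := mean_stopped_count k_ge1 nTm km r_inj cardB B_earlier stopA d0.
  apply: le_trans (_ : mean (fun s => k%:R + #|[set v in V |
      (v \in active s (A s)) && [disjoint B v & active s (A s)]]|%:R) <= _).
    by apply: ler_mean => s; rewrite -natrD ler_nat CC_le.
  rewrite meanD mean_const.
  rewrite (eq_mean (fun s => countE R V B (active s (A s)))).
  apply: le_trans (lerD (lexx _) H) _.
  have mn : m%:R <= eps / 3 * n%:R.
    apply: le_trans (_ : q%:R^-1 * n%:R <= _); last by rewrite ler_wpM2r // ltW.
    by rewrite mulrC ler_pdivlMr // -natrM ler_nat.
  have nK : n%:R ^+ k / (m - k)%:R ^+ k.+1 <= K / n%:R.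
    rewrite ler_pdivrMr ?exprn_gt0 // mulrAC ler_pdivlMr // -exprSr -exprMn.
    by rewrite -natrM lerXn2r ?nnegrE ?ler0n // ler_nat.
  have err : n%:R ^+ k / (m - k)%:R ^+ k.+1 *
      ((4 * k + 5)%:R * n%:R / delta + delta * n%:R ^+ 2) <=
      K * (4 * k + 5)%:R / delta + eps / 3 * n%:R.
    apply: le_trans (ler_wpM2r _ nK) _.
      by rewrite ltW // addr_gt0 // mulr_gt0 ?invr_gt0 ?exprn_gt0 // mulr_gt0 // ltr0n addnS.
    rewrite le_eqVlt; apply/orP; left; apply/eqP.
    by rewrite /delta; field; rewrite !gt_eqF.
  rewrite /L in Ln; move: Ln mn err; rewrite -/c; lra.
have c0 : 0 <= c by rewrite divr_ge0 // exprn_ge0 // ler0n.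
rewrite /max_score; elim/big_ind: _ => [|x y xle yle|A stopA].
- by rewrite mulr_ge0 ?ler0n // addr_ge0 // ltW.
- by rewrite ge_max xle.
- exact: score_le.
Qed.
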